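(* For all positive integers $n,h,k$ we have $\mathrm{ex}(n,\mathit{St}_3(h,k))\lesssim \max\{kn^2,h^2k^2n\}$, i.e. there is an absolute constant $C$ such that every $3$-graph on $n$ vertices with more than $C\max\{kn^2,h^2k^2n\}$ edges contains a copy of $\mathit{St}_3(h,k)$.
   Context: A $3$-graph is a $3$-uniform hypergraph; $\mathrm{ex}(n,\mathcal{F})$ is the maximum number of edges of an $n$-vertex $3$-graph with no copy of $\mathcal{F}$. $\mathit{St}_3(h,k)$ is the $3$-graph with a vertex $v$ contained in all edges such that removing $v$ from every edge yields $h$ vertex-disjoint copies of the graph star $S_k$ (a star with $k$ leaves); it has $hk$ edges and $1+h+hk$ vertices. *)

(* Defs.v *)
From mathcomp Require Import all_boot.

Set Implicit Arguments.
Unset Strict Implicit.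
Unset Printing Implicit Defensive.

(* A hypergraph on the vertex set [V] is given by its set of edges. *)
Definition is_3graph (V : finType) (E : {set {set V}}) : bool :=
  [forall e in E, #|e| == 3].

(* The copy need not be induced. *)
Definition contains_copy (V W : finType)
    (E : {set {set V}}) (F : {set {set W}}) : bool :=
  [exists f : {ffun W -> V},
    injectiveb f && [forall e in F, f @: e \in E]].

Definition ex (n : nat) (W : finType) (F : {set {set W}}) : nat :=
  \max_(E : {set {set 'I_n}} | is_3graph E && ~~ contains_copy E F) #|E|.

(* [None] is the vertex lying in all edges, [Some (i, None)] is the centre of
   the [i]-th star and [Some (i, Some j)] is its [j]-th leaf. *)
Definition St3_vertex (h k : nat) : finType :=
  option ('I_h * option 'I_k)%type.

Definition St3 (h k : nat) : {set {set St3_vertex h k}} :=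
  [set [set None; Some (i, None); Some (i, Some j)] | i : 'I_h, j : 'I_k].

(* Main.v *)
Require Import Defs.
From mathcomp Require Import all_boot.
From mathcomp Require Import zify.

Set Implicit Arguments.
Unset Strict Implicit.
Unset Printing Implicit Defensive.

(** If the link graph of [v] has no [h] disjoint [k]-stars, a maximal packing of
    such stars covers a set [W v] of at most [h (k + 1)] vertices, and outside
    [W v] the link has maximum degree less than [k].  Hence at most [k n^2] edges
    contain a vertex [v] whose two companions both lie outside [W v].  In any
    other edge every vertex [v] has an out-neighbour (a companion in [W v]), and
    three vertices with this property span a directed path [c -> a -> b]; as all
    out-degrees are at most [h (k + 1)], there are at most [n (h (k + 1))^2] such
    paths. *)

Lemma card_le_fibres (A B : finType) (D : {set A}) (S : {set A * B}) (m : nat) :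
  {in S, forall p, p.1 \in D} ->
  (forall a, a \in D -> #|[set b | (a, b) \in S]| <= m) -> #|S| <= #|D| * m.
Proof.
move=> SD Sm; rewrite -sum1_card (partition_big fst (mem D)) //= -sum_nat_const.
apply: leq_sum => a aD; rewrite sum1dep_card; apply: leq_trans (Sm a aD).
rewrite -(card_in_imset (f := snd)) => [|[a1 b] [a2 b']]; last first.
  by rewrite !inE /= => /andP[_ /eqP->] /andP[_ /eqP->] ->.
apply/subset_leq_card/subsetP => _ /imsetP[[a' b] + ->].
by rewrite !inE /= => /andP[abS /eqP <-].
Qed.

(* A star is encoded as the sequence of its centre followed by its leaves. *)
Definition is_star (T : eqType) (e : rel T) (k : nat) (t : seq T) : bool :=
  if t is c :: l then (size l == k) && all (e c) l else false.

Definition star_packing (T : eqType) (e : rel T) (k : nat) (s : seq (seq T)) :=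
  uniq (flatten s) && all (is_star e k) s.

Lemma size_star (T : eqType) (e : rel T) (k : nat) (t : seq T) :
  is_star e k t -> size t = k.+1.
Proof. by case: t => //= c l /andP[/eqP->]. Qed.

Lemma size_flatten_stars (T : eqType) (e : rel T) (k : nat) (s : seq (seq T)) :
  all (is_star e k) s -> size (flatten s) = size s * k.+1.
Proof.
by elim: s => //= t s IHs /andP[tP sP]; rewrite size_cat (size_star tP) IHs // mulSn.
Qed.

(** Greedy argument by induction on [h]: a packing of [h] stars is extended by any outside vertex
    with [k] neighbours outside the packing. If there is none, the vertices of the packing form the
    cover [W]. *)
Lemma star_packing_or_cover (T : finType) (e : rel T) (h k : nat) :
  irreflexive e ->
  (exists2 s, star_packing e k s & size s = h) \/
  (exists2 W : {set T}, #|W| <= h * k.+1 &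
     forall x, x \notin W -> #|[set y | (y \notin W) && e x y]| < k).
Proof.
move=> e_irr; elim: h => [|h [[s sP sh]|[W Wh WP]]].
- by left; exists [::].
- pose W := [set x in flatten s].
  have [/existsP[x /andP[xW xdeg]]|/existsPn noext] :=
    boolP [exists x, (x \notin W) && (k <= #|[set y | (y \notin W) && e x y]|)].
    left; set N := [set y | _] in xdeg.
    pose l := take k (enum N).
    have lN y : y \in l -> (y \notin flatten s) && e x y.
      by move/mem_take; rewrite mem_enum !inE.
    exists ((x :: l) :: s); last by rewrite /= sh.
    case/andP: sP => s_uniq sP; apply/andP; split=> /=.
      rewrite mem_cat negb_or; apply/andP; split.
        rewrite inE in xW; rewrite xW andbT.
        by apply/negP => /lN; rewrite e_irr andbF.
      rewrite cat_uniq s_uniq take_uniq ?enum_uniq //= andbT.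
      by apply/hasPn => y ys; apply/negP => /lN; rewrite ys.
    rewrite sP size_takel -?cardE // eqxx andbT /=.
    by apply/allP => y /lN /andP[].
  right; exists W.
    rewrite cardsE (leq_trans (card_size _)) //.
    by case/andP: sP => _ /size_flatten_stars ->; rewrite sh leq_mul2r leqnSn orbT.
  by move=> x xW; have := noext x; rewrite xW /= -ltnNge.
- right; exists W => //; apply: leq_trans Wh _.
  by rewrite leq_mul2r leqnSn orbT.
Qed.

(** Both entries are located in [flatten s], where equal values have equal indices, and a flat index
    determines block and offset. This gives injectivity of the embedding of [St3 h k]. *)
Lemma nth_nth_flatten_inj (T : eqType) (x0 : T) (s : seq (seq T)) (i i' p p' : nat) :
  uniq (flatten s) -> p < size (nth [::] s i) -> p' < size (nth [::] s i') ->
  nth x0 (nth [::] s i) p = nth x0 (nth [::] s i') p' -> i = i' /\ p = p'.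
Proof.
(* The default block is empty, so a valid offset forces [j] to be in range. *)
have nthE j q : q < size (nth [::] s j) -> q < nth 0 (shape s) j.
  by have [js|js] := ltnP j (size s); [rewrite (nth_map [::]) | rewrite nth_default].
have flatE j q : q < nth 0 (shape s) j ->
    nth x0 (nth [::] s j) q = nth x0 (flatten s) (flatten_index (shape s) j q).
  by move=> qs; rewrite nth_flatten flatten_indexKl // flatten_indexKr.
move=> s_uniq /nthE ps /nthE ps'; rewrite !flatE // => /eqP.
rewrite nth_uniq ?size_flatten ?flatten_indexP // => /eqP eq_ip.
by split; [rewrite -(flatten_indexKl ps) eq_ip flatten_indexKl
          | rewrite -(flatten_indexKr ps) eq_ip flatten_indexKr].
Qed.

Definition link (V : finType) (E : {set {set V}}) (v : V) : rel V :=
  fun x y => [set v; x; y] \in E.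

Lemma edge_distinct (V : finType) (E : {set {set V}}) (x y z : V) :
  is_3graph E -> [set x; y; z] \in E -> [/\ x != y, x != z & y != z].
Proof.
move=> /forall_inP E3 /E3; rewrite setUC cardsU1 cards2 !inE.
by rewrite [z == x]eq_sym [z == y]eq_sym; case: (x == y) (x == z) (y == z) => [] [] [].
Qed.

Lemma link_packing_copy (V : finType) (E : {set {set V}}) (v : V) (h k : nat)
    (s : seq (seq V)) :
  is_3graph E -> 0 < k -> star_packing (link E v) k s -> size s = h ->
  contains_copy E (St3 h k).
Proof.
move=> E3 k_gt0 /andP[s_uniq sP] sh.
have starP (i : 'I_h) : is_star (link E v) k (nth [::] s i).
  by apply: (allP sP); rewrite mem_nth ?sh.
(* Position 0 of a star is its centre, hence the shift for leaves. *)
pose pos (o : option 'I_k) : nat := if o is Some j then j.+1 else 0.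
have pos_lt (i : 'I_h) o : pos o < size (nth [::] s i).
  by rewrite (size_star (starP i)); case: o => //= j; rewrite ltnS.
have pos_inj : injective pos by move=> [i|] [j|] //= [] /val_inj ->.
pose f : {ffun St3_vertex h k -> V} :=
  [ffun w : option ('I_h * option 'I_k) => if w is Some (i, o) then nth v (nth [::] s i) (pos o) else v].
have linkP (i : 'I_h) (j : 'I_k) :
    link E v (f (Some (i, None))) (f (Some (i, Some j))).
  rewrite !ffunE /=; case: (nth [::] s i) (starP i) => //= c l /andP[/eqP lk].
  by move/allP; apply; rewrite mem_nth ?lk.
(* Each vertex of the packing shares an edge of [E] with [v], so it differs from [v]. For a centre,
   the edge through leaf 0 is used, which exists since [0 < k]. *)
have f_neq p : f (Some p) != v.
  rewrite eq_sym; case: p => i [j|]; first by case: (edge_distinct E3 (linkP i j)).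
  by case: (edge_distinct E3 (linkP i (Ordinal k_gt0))).
apply/existsP; exists f; apply/andP; split.
  apply/injectiveP => -[p|] [p'|] // fE; last 2 first.
  - by have := f_neq p; rewrite fE [f None]ffunE eqxx.
  - by have := f_neq p'; rewrite -fE [f None]ffunE eqxx.
  case: p p' fE => i o [i' o']; rewrite !ffunE => fE.
  have [/val_inj-> /pos_inj->//] :=
    nth_nth_flatten_inj s_uniq (pos_lt i o) (pos_lt i' o') fE.
apply/forall_inP => _ /imset2P[i j _ _ ->].
by rewrite !imsetU !imset_set1 [f None]ffunE; apply: linkP.
Qed.

Lemma card_3graph_covered_links (V : finType) (E : {set {set V}})
    (W : V -> {set V}) (k m : nat) :
  is_3graph E -> (forall v, #|W v| <= m) ->
  (forall v x, x \notin W v ->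
     #|[set y | (y \notin W v) && link E v x y]| <= k) ->
  #|E| <= #|V| * #|V| * k + #|V| * (m * m).
Proof.
move=> E3 Wm Wk.
(* [S1] collects the edges seen from a vertex with both companions outside its cover; [S2] collects
   the directed paths [c -> a -> b], where [a -> b] means [b \in W a]. *)
pose S1 := [set p : V * V * V |
  [&& p.1.2 \notin W p.1.1, p.2 \notin W p.1.1 & link E p.1.1 p.1.2 p.2]].
pose S2 := [set p : V * (V * V) | (p.2.1 \in W p.1) && (p.2.2 \in W p.2.1)].
have S1_le : #|S1| <= #|V| * #|V| * k.
  rewrite -card_prod -cardsT; apply: card_le_fibres => [p|[v x] _]; first by rewrite inE.
  have [xW|xW] := boolP (x \in W v).
    by rewrite (eq_card (B := set0)) ?cards0 // => y; rewrite !inE xW.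
  by apply: leq_trans (Wk v x xW); apply/subset_leq_card/subsetP => y; rewrite !inE xW.
have S2_le : #|S2| <= #|V| * (m * m).
  rewrite -cardsT; apply: card_le_fibres => [p|c _]; first by rewrite inE.
  apply: (@leq_trans (#|W c| * m)); last by rewrite leq_mul2r Wm orbT.
  apply: card_le_fibres => [p|a aW]; first by rewrite !inE => /andP[].
  by apply: leq_trans (Wm a); apply/subset_leq_card/subsetP => b; rewrite !inE => /andP[].
pose g1 (p : V * V * V) := [set p.1.1; p.1.2; p.2].
pose g2 (p : V * (V * V)) := [set p.1; p.2.1; p.2.2].
apply: leq_trans (leq_add S1_le S2_le).
apply: leq_trans (leq_add (leq_imset_card g1 (mem S1)) (leq_imset_card g2 (mem S2))).
apply: leq_trans (leq_card_setU _ _); apply/subset_leq_card/subsetP => e eE.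
have e3 : #|e| == 3 by apply: (forall_inP E3).
have [x xe] : exists x, x \in e by apply/card_gt0P; rewrite (eqP e3).
have /cards2P[y [z [_ e_yz]]] : #|e :\ x| == 2 by move: e3; rewrite (cardsD1 x e) xe.
have eE' : e = [set x; y; z] by rewrite -(setD1K xe) e_yz setUA.
have in1 a b c : e = [set a; b; c] -> b \notin W a -> c \notin W a ->
    e \in g1 @: S1 :|: g2 @: S2.
  move=> e_abc bW cW; rewrite inE; apply/orP; left; apply/imsetP.
  by exists (a, b, c); rewrite // inE /= bW cW /link -e_abc.
have in2 a b c : e = [set a; b; c] -> b \in W a -> c \in W b ->
    e \in g1 @: S1 :|: g2 @: S2.
  move=> e_abc bW cW; rewrite inE; apply/orP; right; apply/imsetP.
  by exists (a, (b, c)); rewrite // inE /= bW cW.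
(* Two transpositions yield all six orderings of [e], to which [in1] and [in2] are then applied. *)
have swap12 a b c : e = [set a; b; c] -> e = [set b; a; c] by rewrite (setUC [set a]).
have swap23 a b c : e = [set a; b; c] -> e = [set a; c; b] by rewrite setUAC.
have eyxz := swap12 _ _ _ eE'; have exzy := swap23 _ _ _ eE'.
have eyzx := swap23 _ _ _ eyxz; have ezxy := swap12 _ _ _ exzy.
have ezyx := swap23 _ _ _ ezxy.
(* A vertex without out-neighbour in [e] is handled by [in1]. Otherwise let [x -> y]: either
   [y -> z] gives a path, or [y -> x], and then the arc leaving [z] starts a path through [x] and
   [y]. *)
have [xy|xy] := boolP (y \in W x); have [xz|xz] := boolP (z \in W x);
have [yx|yx] := boolP (x \in W y); have [yz|yz] := boolP (z \in W y);
have [zx|zx] := boolP (x \in W z); have [zy|zy] := boolP (y \in W z);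
solve [eauto].
Qed.

Theorem theorem5p1 :
  exists C : nat, forall n h k : nat, 0 < n -> 0 < h -> 0 < k ->
    ex n (St3 h k) <= C * maxn (k * n ^ 2) (h ^ 2 * k ^ 2 * n).
Proof.
(* As [k.+1 <= 2 * k], the paths number at most four times [h ^ 2 * k ^ 2 * n]; the term [k * n ^ 2]
   adds one more maximum. *)
exists 5 => n h k n_gt0 h_gt0 k_gt0; apply/bigmax_leqP => E /andP[E3 noSt].
(* The conditions are boolean so that [xchoose] can select a cover for every [v]. *)
have cover v : exists W : {set 'I_n}, (#|W| <= h * k.+1) &&
    [forall x, (x \notin W) ==> (#|[set y | (y \notin W) && link E v x y]| <= k)].
  have irr : irreflexive (link E v).
    by move=> x; apply/negP => /(edge_distinct E3)[]; rewrite eqxx.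
  case: (star_packing_or_cover h k irr) => [[s sP sh]|[W Wm Wk]].
    by rewrite (link_packing_copy E3 k_gt0 sP sh) in noSt.
  exists W; rewrite Wm /=; apply/forallP => x; apply/implyP => /Wk; exact: ltnW.
pose W v := xchoose (cover v).
have W_card v : #|W v| <= h * k.+1 by case/andP: (xchooseP (cover v)).
have W_deg v x : x \notin W v -> #|[set y | (y \notin W v) && link E v x y]| <= k.
  by case/andP: (xchooseP (cover v)) => _ /forallP/(_ x)/implyP.
apply: leq_trans (card_3graph_covered_links E3 W_card W_deg) _; rewrite card_ord.
have hk : h * k.+1 <= 2 * (h * k) by nia.
have := leq_mul hk hk.
nia.
Qed.
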